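(* Let $\mathbf x_1,\dots,\mathbf x_n\in\mathbb R^d$, let $\ell_1,\dots,\ell_n:\mathbb R\to\mathbb R$ be convex, twice differentiable and smooth, let $\lambda>0$ and $0<k\le n$, and let $$\mathcal L(\mathbf w)=\frac1n\sum_{i=1}^n\ell_i(\mathbf w^\top\mathbf x_i)+\frac\lambda2\|\mathbf w\|^2 .$$ Let $\widehat{\mathcal L}_1,\widehat{\mathcal L}_2,\dots$ be i.i.d. copies of the random function $$\widehat{\mathcal L}(\mathbf w)=\frac1k\sum_{i=1}^n b_i\,\ell_i(\mathbf w^\top\mathbf x_i)+\frac\lambda2\|\mathbf w\|^2,\qquad b_1,\dots,b_n\ \text{independent } \mathrm{Bernoulli}(k/n).$$ Fix $\mathbf w\in\mathbb R^d$ and define $a_t=\det\big(\nabla^2\widehat{\mathcal L}_t(\mathbf w)\big)$, $\widehat{\mathbf p}_t=\nabla^{-2}\widehat{\mathcal L}_t(\mathbf w)\,\nabla\mathcal L(\mathbf w)$ and $\mathbf p=\nabla^{-2}\mathcal L(\mathbf w)\,\nabla\mathcal L(\mathbf w)$. Then, almost surely, $$\frac{\sum_{t=1}^m a_t\,\widehat{\mathbf p}_t}{\sum_{t=1}^m a_t}\ \longrightarrow\ \mathbf p\qquad\text{as } m\to\infty .$$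
   Context: $\nabla f$ and $\nabla^2 f$ denote the gradient and Hessian of $f$, and $\nabla^{-2}f(\mathbf w)=(\nabla^2 f(\mathbf w))^{-1}$. Explicitly, $\nabla^2\mathcal L(\mathbf w)=\frac1n\sum_i\ell_i''(\mathbf w^\top\mathbf x_i)\mathbf x_i\mathbf x_i^\top+\lambda\mathbf I$, $\nabla\mathcal L(\mathbf w)=\frac1n\sum_i\ell_i'(\mathbf w^\top\mathbf x_i)\mathbf x_i+\lambda\mathbf w$, and $\nabla^2\widehat{\mathcal L}(\mathbf w)=\frac1k\sum_i b_i\ell_i''(\mathbf w^\top\mathbf x_i)\mathbf x_i\mathbf x_i^\top+\lambda\mathbf I$. ''Smooth'' refers to the usual optimization notion (Lipschitz derivative). *)

(* Defs.v *)
From HB Require Import structures.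
From mathcomp Require Import all_boot all_order all_algebra finmap.
From mathcomp Require Import all_classical all_reals all_analysis.

Set Implicit Arguments.
Unset Strict Implicit.
Unset Printing Implicit Defensive.

Import Order.TTheory GRing.Theory Num.Theory.
Import numFieldNormedType.Exports.

Local Open Scope classical_set_scope.
Local Open Scope ring_scope.

Section euclidean.
Context {R : realType} {d : nat}.
Implicit Types (u v w : 'cV[R]_d) (f : 'cV[R]_d -> R).

Definition dot u v : R := (u^T *m v) 0 0.

(* The norm [`|w|] of the library on matrices is the sup norm, hence this
   definition of the squared Euclidean norm. *)
Definition sqnorm w : R := dot w w.

Definition gradient f w : 'cV[R]_d := \col_i 'D_(delta_mx i 0) f w.

Definition hessian f w : 'M[R]_d :=
  \matrix_(i, j) 'D_(delta_mx j 0) (fun u => gradient f u i 0) w.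

End euclidean.

Section losses.
Context {R : realType} {d n : nat}.
Variables (x : 'I_n -> 'cV[R]_d) (l : 'I_n -> R -> R) (lambda : R).

Definition loss (w : 'cV[R]_d) : R :=
  n%:R^-1 * (\sum_(i < n) l i (dot w (x i))) + lambda / 2 * sqnorm w.

Definition subsampled_loss (k : R) (b : 'I_n -> bool) (w : 'cV[R]_d) : R :=
  k^-1 * (\sum_(i < n) (b i)%:R * l i (dot w (x i))) + lambda / 2 * sqnorm w.

End losses.

Definition twice_differentiable {R : realType} (f : R -> R) : Prop :=
  (forall y, derivable f y 1) /\ (forall y, derivable f^`()%classic y 1).

(* Smoothness in the sense of optimization, not infinite differentiability. *)
Definition smooth {R : realType} (f : R -> R) : Prop :=
  lipschitz (f^`()%classic : R^o -> R^o).

Definition mutually_independent {R : realType} {disp disp' : measure_display}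
    {Omega : measurableType disp} {U : measurableType disp'}
    (P : probability Omega R) {I : choiceType} (X : I -> {RV P >-> U}) : Prop :=
  forall (J : {fset I}) (A : I -> set U),
    (forall i, i \in J -> measurable (A i)) ->
    (P (\bigcap_(i in [set` J]) (X i @^-1` A i)) =
     \prod_(i <- J) P (X i @^-1` A i))%E.

(* Main.v *)
Require Import Defs.
From HB Require Import structures.
From mathcomp Require Import all_boot all_order all_algebra finmap.
From mathcomp Require Import all_classical all_reals all_analysis.
From mathcomp Require Import perm measurable_realfun ring lra zify.

Set Implicit Arguments.
Unset Strict Implicit.
Unset Printing Implicit Defensive.

Import Order.TTheory GRing.Theory Num.Theory.
Import numFieldNormedType.Exports.

Local Open Scope classical_set_scope.
Local Open Scope ring_scope.

(* The subsampled Hessian is [lambda I] plus a sum of rank-one terms weighted by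
   the Bernoulli variables [b_i]. Its determinant and the entries of its adjugate
   are affine in each [b_i] separately, so by independence their expectations are
   obtained by replacing [b_i] with its mean [k / n], which turns the subsampled
   Hessian into the true Hessian [H]. Since [det (A) A^-1 = adj A], the law of
   large numbers sends the averages of [a_t] and of [a_t p_t] to [det H] and
   [adj H *m grad L]; the quotient of these limits is [H^-1 *m grad L]. *)

(** * Multiaffine functions and determinants of rank-one updates *)

(** Being affine in each variable separately is encoded by an explicit expansion into square-free
    monomials: on 0/1 variables, each such monomial is the indicator of an event. *)
Definition multiaffine (R : comNzRingType) (n : nat) (f : ('I_n -> R) -> R) :=
  exists c : {set 'I_n} -> R,
    forall y, f y = \sum_(S : {set 'I_n}) c S * \prod_(i in S) y i.

Section multiaffine.
Context {R : comNzRingType} {n : nat}.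
Implicit Types (f : ('I_n -> R) -> R) (y : 'I_n -> R).

Lemma multiaffine_ext f g : f =1 g -> multiaffine f -> multiaffine g.
Proof. by move=> fg [c fE]; exists c => y; rewrite -fg fE. Qed.

Lemma multiaffineZ (a : R) f : multiaffine f -> multiaffine (fun y => a * f y).
Proof.
move=> [c fE]; exists (fun S => a * c S) => y.
by rewrite fE mulr_sumr; apply: eq_bigr => S _; rewrite mulrA.
Qed.

Lemma multiaffine_sum (I : finType) (f : I -> ('I_n -> R) -> R) :
  (forall j, multiaffine (f j)) -> multiaffine (fun y => \sum_j f j y).
Proof.
move=> /boolp.choice[c fE]; exists (fun S => \sum_j c j S) => y.
under eq_bigr do rewrite fE.
by rewrite exchange_big; apply: eq_bigr => S _; rewrite mulr_suml.
Qed.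

Lemma multiaffine_prod (a b : 'I_n -> R) :
  multiaffine (fun y => \prod_i (a i + y i * b i)).
Proof.
(* When the product is expanded, [S] collects the factors from which the term in [y i] is taken. *)
exists (fun S : {set _} => \prod_i (if i \in S then b i else a i)) => y.
under eq_bigr do rewrite addrC.
rewrite bigA_distr; apply: eq_bigr => S _.
rewrite [\prod_(i in S) _]big_mkcond -big_split /=; apply: eq_bigr => i _.
by case: ifP => _; rewrite ?mulr1 // mulrC.
Qed.

(* The determinant is that of the block matrix [[1, - diag(y) v], [u, A]], and
   its Leibniz expansion uses each of the first [n] rows exactly once. *)
Lemma multiaffine_det m (A : 'M[R]_m) (u : 'I_n -> 'cV[R]_m)
    (v : 'I_n -> 'rV[R]_m) :
  multiaffine (fun y => \det (A + \sum_i y i *: (u i *m v i))).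
Proof.
pose U : 'M[R]_(m, n) := \matrix_(r, i) u i r 0.
pose B y : 'M[R]_(n, m) := \matrix_(i, s) (- (y i * v i 0 s)).
pose M y : 'M[R]_(n + m) := block_mx 1%:M (B y) U A.
have detM y : \det (A + \sum_i y i *: (u i *m v i)) = \det (M y).
  have -> : A + \sum_i y i *: (u i *m v i) = A - U *m B y.
    apply/matrixP => r s; rewrite !mxE summxE -sumrN; congr (_ + _).
    apply: eq_bigr => i _.
    by rewrite !mxE big_ord1 mulrN opprK mulrCA.
  (* Block elimination: [A - U *m B y] is the Schur complement of the identity block. *)
  have -> : M y = block_mx 1%:M 0 U 1%:M *m block_mx 1%:M (B y) 0 (A - U *m B y).
    by rewrite mulmx_block !mul1mx !mul0mx !mulmx1 !addr0 addrC subrK.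
  by rewrite det_mulmx det_lblock det_ublock !det1 !mul1r.
apply: (@multiaffine_ext (fun y => \sum_(s : 'S_(n + m)) ((-1) ^+ s *
   \prod_(j < m) row_mx U A j (s (rshift n j))) *
   \prod_(i < n) (row_mx 1%:M 0 i (s (lshift m i))
      + y i * row_mx 0 (\matrix_(i, s) (- v i 0 s)) i (s (lshift m i))))).
  move=> y; rewrite detM; apply: eq_bigr => s _.
  rewrite big_split_ord /= -mulrA; congr (_ * _); rewrite mulrC.
  congr (_ * _); apply: eq_bigr => i _; last by rewrite col_mxEd.
  rewrite col_mxEu; case: (split_ordP (s (lshift m i))) => j ->.
    by rewrite !row_mxEl !mxE mulr0 addr0.
  by rewrite !row_mxEr !mxE add0r mulrN.
apply: multiaffine_sum => s; apply: multiaffineZ; exact: multiaffine_prod.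
Qed.

(** Deleting a row and a column keeps the shape of a constant matrix plus weighted rank-one terms,
    so [multiaffine_det] applies to each cofactor. *)
Lemma multiaffine_adj m (A : 'M[R]_m) (u : 'I_n -> 'cV[R]_m)
    (v : 'I_n -> 'rV[R]_m) (r s : 'I_m) :
  multiaffine (fun y => (\adj (A + \sum_i y i *: (u i *m v i))) r s).
Proof.
have := multiaffineZ ((-1) ^+ (s + r)) (multiaffine_det (row' s (col' r A))
  (fun i => row' s (u i)) (fun i => col' r (v i))).
apply: multiaffine_ext => y; rewrite mxE; congr (_ * \det _).
apply/matrixP => i j; rewrite !mxE !summxE; congr (_ + _).
by apply: eq_bigr => k _; rewrite !mxE; under eq_bigr do rewrite !mxE.
Qed.

End multiaffine.

(** * Invertibility of the Hessians, from convexity *)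

(** Positive definiteness: if [v] is in the left kernel, pairing with [v^T] writes 0 as [lambda]
    times the squared norm of [v] plus nonnegative terms, so [v] vanishes. *)
Lemma unitmx_add_rank1_ge0 (R : realFieldType) (d n : nat) (lambda : R)
    (y : 'I_n -> R) (x : 'I_n -> 'cV[R]_d) : 0 < lambda -> (forall i, 0 <= y i) ->
  lambda%:M + \sum_i y i *: (x i *m (x i)^T) \in unitmx.
Proof.
move=> lambda_gt0 y_ge0; rewrite -row_free_unit; apply/inj_row_free => v.
move=> /(congr1 (fun u => (u *m v^T) 0 0)).
rewrite mul0mx [RHS]mxE mulmxDr mulmxDl mxE mul_mx_scalar -scalemxAl mxE.
rewrite mulmx_sumr mulmx_suml summxE => vHv.
have sq_ge0 : 0 <= \sum_i (v *m (y i *: (x i *m (x i)^T)) *m v^T) 0 0.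
  apply: sumr_ge0 => i _; rewrite -scalemxAr -scalemxAl mxE mulr_ge0 //.
  rewrite mulmxA -[(_ *m v^T)]mulmxA -trmx_mul mxE big_ord1 [_^T _ _]mxE.
  exact: sqr_ge0.
have vv_ge0 k : 0 <= v 0 k * v^T k 0 by rewrite mxE; exact: sqr_ge0.
have vv0 : (v *m v^T) 0 0 = 0.
  have vv : 0 <= (v *m v^T) 0 0 by rewrite mxE sumr_ge0.
  move/eqP: vHv; rewrite paddr_eq0 ?mulr_ge0 // 1?ltW // => /andP[+ _].
  by rewrite mulf_eq0 gt_eqF //= => /eqP.
apply/rowP => k; rewrite mxE; move: vv0; rewrite mxE.
move=> /psumr_eq0P => /(_ (fun k _ => vv_ge0 k) k isT).
by rewrite mxE => /eqP; rewrite mulf_eq0 orbb => /eqP.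
Qed.

(** By convexity, the difference quotients at [a] in the direction [c - a] are at most [f c - f a]
    for steps [t] in (0, 1); the inequality passes to the right-hand limit. *)
Lemma convex_tangent_le (R : realType) (f : R -> R) (a c : R) :
  convex_function (setT : set R^o) f -> derivable f a 1 ->
  f^`()%classic a * (c - a) <= f c - f a.
Proof.
move=> cf df.
have /derivable1_diffP dff := df.
have dfv : derivable f a (c - a) by exact: diff_derivable.
have -> : f^`()%classic a * (c - a) = 'D_(c - a) f a.
  by rewrite (deriveE _ dff) (deriv1E df) [LHS]mulrC.
rewrite /derive cvg_at_rightE; last exact: dfv.
apply: limr_le.
  apply/cvg_ex; exists ('D_(c - a) f a); exact: cvg_dnbhs_at_right dfv.
near=> t.
have t0 : 0 < t by near: t; exact: nbhs_right_gt.
have t1 : t < 1 by near: t; apply: nbhs_right_lt.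
have t01 : (0 <= t <= 1)%R by rewrite !ltW.
have := cf (Itv01 (ltW t0) (ltW t1)) c a; rewrite !inE => /(_ I I).
rewrite !convRE /= /conv /= /unstable.onem => H.
rewrite /= ler_pdivrMl //.
have -> : t *: (c - a) + a = t *: c + (1 - t) *: a.
  by rewrite /GRing.scale /=; ring.
move: H; rewrite /GRing.scale /=; lra.
Unshelve. all: by end_near. Qed.

(** Adding the tangent inequalities at [a] and at [t + a] shows that the derivative is monotone, so
    its difference quotients are nonnegative. *)
Lemma convex_derive2_ge0 (R : realType) (f : R -> R) (a : R) :
  convex_function (setT : set R^o) f -> twice_differentiable f ->
  0 <= (f^`()^`())%classic a.
Proof.
move=> cf [df ddf].
rewrite derive1E; apply: limr_ge; first exact: (ddf a).
near=> t.
have t0 : t != 0 by near: t; exact: nbhs_dnbhs_neq.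
have h1 := convex_tangent_le (t + a) cf (df a).
have h2 := convex_tangent_le a cf (df (t + a)).
rewrite /GRing.scale /= mulr1.
(* The step [t] may be negative; factoring out the square of [t^-1] avoids a case split on its
   sign. *)
have -> : t^-1 * (f^`()%classic (t + a) - f^`()%classic a) =
  t^-1 ^+ 2 * (t * (f^`()%classic (t + a) - f^`()%classic a)) by field.
apply: mulr_ge0; first exact: sqr_ge0.
rewrite addrK in h1; rewrite opprD addrA addrAC subrr add0r in h2; lra.
Unshelve. all: by end_near. Qed.

(** * Gradient and Hessian of a weighted regularized loss *)

Section ridge.
Context {R : realType} {d n : nat}.
Implicit Types (w v : 'cV[R]_d) (c : 'I_n -> R).

Lemma dotDl u v w : dot (u + v) w = dot u w + dot v w :> R.
Proof. by rewrite /dot linearD mulmxDl mxE. Qed.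

Lemma dotZl (a : R) u w : dot (a *: u) w = a * dot u w :> R.
Proof. by rewrite /dot linearZ -scalemxAl mxE. Qed.

Lemma dot_delta (i : 'I_d) w : dot (delta_mx i 0) w = w i 0.
Proof. by rewrite /dot trmx_delta -rowE mxE. Qed.

(** A directional derivative depends only on the restriction of [f] to a line, which reduces the
    computations below to one-variable calculus. *)
Lemma is_derive_along_line (f : 'cV[R]_d -> R) w v (df : R) :
  is_derive (0 : R) 1 (fun h : R => f (h *: v + w)) df -> is_derive w v f df.
Proof.
have E : (fun h : R => h^-1 *: (f ((h *: (1 : R) + 0) *: v + w) - f (0 *: v + w)))
       = (fun h : R => h^-1 *: (f (h *: v + w) - f w)).
  apply/funext => h.
  rewrite addr0 scale0r add0r; congr (_ *: (f (_ *: v + w) - f w)).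
  exact: mulr1.
move=> [Hd Hv]; split.
  by move: Hd; rewrite /derivable E.
by move: Hv; rewrite /derive E.
Qed.

Lemma is_derive_dotl w v x : is_derive w v (dot ^~ x : _ -> R) (dot v x).
Proof.
apply: is_derive_along_line.
under eq_fun do rewrite dotDl dotZl.
apply: is_derive_eq; rewrite /GRing.scale /=. ring.
Qed.

Lemma is_derive_comp_dot (f : R -> R) w v x : derivable f (dot w x) 1 ->
  is_derive w v (fun u => f (dot u x)) (f^`()%classic (dot w x) * dot v x).
Proof.
move=> df; apply: is_derive_along_line.
apply: (@is_derive1_comp _ f (fun h : R => dot (h *: v + w) x)).
  rewrite scale0r add0r; apply: DeriveDef => //; by rewrite derive1E.
under eq_fun do rewrite dotDl dotZl.
apply: is_derive_eq; rewrite /GRing.scale /=; ring.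
Qed.

Lemma dotC u v : dot u v = dot v u :> R.
Proof. by rewrite /dot -[u in RHS]trmxK -trmx_mul [RHS]mxE. Qed.

Lemma is_derive_sqnorm w v : is_derive w v (sqnorm : _ -> R) (2 * dot v w).
Proof.
apply: is_derive_along_line.
have -> : (fun h : R => sqnorm (h *: v + w)) =
    (fun h => h * (h * dot v v) + h * (2 * dot v w) + dot w w).
  apply/funext => h; rewrite /sqnorm !(dotDl, dotZl).
  by rewrite dotC dotDl dotZl [dot w (_ + _)]dotC dotDl dotZl [dot w v]dotC; ring.
apply: is_derive_eq; rewrite /GRing.scale /=; ring.
Qed.

(** Common form of the two losses: the weights [n^-1] give [loss], and the weights [k^-1 * b i] give
    [subsampled_loss]. *)
Definition ridge (l : 'I_n -> R -> R) (x : 'I_n -> 'cV[R]_d) (lambda : R) c w :=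
  \sum_(i < n) c i * l i (dot w (x i)) + lambda / 2 * sqnorm w.

Lemma hessian_ridge (l : 'I_n -> R -> R) (x : 'I_n -> 'cV[R]_d) (lambda : R) c w :
  (forall i, twice_differentiable (l i)) ->
  hessian (ridge l x lambda c) w = lambda%:M + \sum_i
    (c i * ((l i)^`()^`())%classic (dot w (x i))) *: (x i *m (x i)^T).
Proof.
move=> dl.
(* The gradient entries are put in the form of linear combinations of functions, ready to be
   differentiated again. *)
have gradE (p : 'I_d) : (fun u => gradient (ridge l x lambda c) u p 0) =
    (\sum_(i < n) (c i * x i p 0) *: (fun u => (l i)^`()%classic (dot u (x i))))
    + lambda *: dot (delta_mx p 0).
  apply/funext => u; rewrite mxE.
  have Dl i := @is_derive_comp_dot (l i) u (delta_mx p 0) (x i) ((dl i).1 _).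
  have Ds := is_derive_sqnorm u (delta_mx p 0).
  have -> : ridge l x lambda c =
     \sum_(i < n) c i *: (fun u => l i (dot u (x i))) + (lambda / 2) *: sqnorm.
    by apply/funext => z; rewrite /= !fctE /ridge fct_sumE.
  rewrite (derive_val (is_derive := is_deriveD
    (is_derive_sum (fun i => is_deriveZ (c i) (Dl i))) (is_deriveZ (lambda / 2) Ds))).
  rewrite !fctE fct_sumE; congr (_ + _).
    apply: eq_bigr => i _.
    by rewrite !fctE /GRing.scale /= dot_delta; ring.
  by rewrite /GRing.scale /=; field.
apply/matrixP => p q; rewrite !mxE gradE summxE.
have Dl i := @is_derive_comp_dot _ w (delta_mx q 0) (x i) ((dl i).2 _).
have Dd : is_derive w (delta_mx q 0) (dot (delta_mx p 0))
    (dot (delta_mx p 0) (delta_mx q 0)).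
  have -> : (dot (delta_mx p 0) : 'cV[R]_d -> R) = dot ^~ (delta_mx p 0).
    by apply/funext => u; exact: dotC.
  exact: is_derive_dotl.
rewrite (derive_val (is_derive := is_deriveD
  (is_derive_sum (fun i => is_deriveZ (c i * x i p 0) (Dl i))) (is_deriveZ lambda Dd))).
rewrite addrC dot_delta mxE eqxx andbT; congr (_ + _).
  apply: eq_bigr => i _.
  by rewrite /GRing.scale /= dot_delta !mxE big_ord1 !mxE; ring.
by rewrite /GRing.scale /= mulr_natr.
Qed.

End ridge.

(** * A strong law of large numbers for pairwise independent events *)

Lemma nat_sqrt_bounds (m : nat) : exists j, (j ^ 2 <= m < j.+1 ^ 2)%N.
Proof.
elim: m => [|m [j /andP[jm mj]]]; first by exists 0%N.
have [?|?] := ltnP m.+1 (j.+1 ^ 2); first by exists j; lia.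
exists j.+1; nia.
Qed.

(** If [j.+1 ^ 2] is the largest square up to [m], then [D] moves by at most [2 * j.+1] between the
    two, which is of order the square root of [m] and negligible after division by [m]. *)
Lemma cvg_average_of_squares (R : realType) (D : nat -> R) :
  (forall m, `|D m.+1 - D m| <= 1) ->
  (fun j => (j.+1 ^ 2)%:R^-1 * D (j.+1 ^ 2)%N) @ \oo --> 0 ->
  (fun m => m%:R^-1 * D m) @ \oo --> 0.
Proof.
move=> D1 Dsq.
have Dn m i : `|D (m + i)%N - D m| <= i%:R.
  elim: i => [|i IH]; first by rewrite addn0 subrr normr0.
  have -> : i.+1%:R = 1 + i%:R :> R by rewrite addrC natr1.
  rewrite addnS -(subrKA (D (m + i)%N)).
  exact: le_trans (ler_normD _ _) (lerD (D1 _) IH).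
apply/cvgrPdist_le => e e0.
have e2 : 0 < e / 2 by rewrite divr_gt0.
have /cvgrPdist_le /(_ _ e2) [N1 _ HN1] := Dsq.
(* With [j.+1^-1 <= e / 4] and [j.+1 ^ 2 <= m], the drift [2 * j.+1] is at most [m * (e / 2)]. *)
have /cvgrPdist_le /(_ (e / 4)) [|N2 _ HN2] := @cvg_harmonic R.
  by rewrite divr_gt0.
(* This threshold excludes the integer square root 0 and forces [j] to be at least [N1] and [N2]. *)
exists ((N1 + N2 + 1) ^ 2)%N => // m /= Hm.
have [[|j] /andP[jm mj]] := nat_sqrt_bounds m; first by nia.
have jN1 : (N1 <= j)%N by nia.
have jN2 : (N2 <= j)%N by nia.
have m0 : 0 < m%:R :> R by rewrite ltr0n; nia.
have := HN1 j jN1; have := HN2 j jN2; rewrite /= !sub0r !normrN.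
rewrite ger0_norm ?invr_ge0 // => H2.
have q0 : 0 < (j.+1 ^ 2)%:R :> R by rewrite ltr0n expn_gt0.
rewrite !normrM !normfV !(@ger0_norm _ _%:R) // ler_pdivrMl // => H1.
rewrite ler_pdivrMl //.
have := Dn (j.+1 ^ 2)%N (m - j.+1 ^ 2)%N; rewrite subnKC // => H3.
have H4 : `|D m| <= (m - j.+1 ^ 2)%:R + `|D (j.+1 ^ 2)%N|.
  rewrite -[D m](subrK (D (j.+1 ^ 2)%N)).
  by apply: le_trans (ler_normD _ _) _; rewrite lerD2r.
have H5 : (m - j.+1 ^ 2)%:R <= (2 * j.+1)%:R :> R by rewrite ler_nat; nia.
have H6 : (j.+1 ^ 2)%:R <= m%:R :> R by rewrite ler_nat.
have H7 : (2 * j.+1)%:R <= m%:R * (e / 2).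
  have: 1 <= j.+1%:R * (e / 4) by rewrite -ler_pdivrMl // mulr1.
  have : j.+1%:R ^+ 2 <= m%:R :> R by rewrite -natrX.
  have : 0 < j.+1%:R :> R by [].
  rewrite natrM; nra.
nra.
Qed.

Section events.
Local Open Scope ereal_scope.
Context {disp : measure_display} {T : measurableType disp} {R : realType}
  (P : probability T R).

Lemma integral_sum_indic (I : Type) (r : seq I) (A : I -> set T) :
  (forall i, measurable (A i)) ->
  \int[P]_w (\sum_(i <- r) \1_(A i) w)%:E = \sum_(i <- r) P (A i).
Proof.
move=> mA; under eq_integral do rewrite -sumEFin.
rewrite ge0_integral_sum //.
- by apply: eq_bigr => i _; rewrite integral_indic // setIT.
- by move=> i; apply/measurable_EFinP; exact: measurable_indic.
Qed.

(** Pairwise independence makes the variance additive, equal to [m * (c - c ^ 2)]; the cruder bound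
    [m] suffices for summability along squares. *)
Lemma second_moment_count_le (E : nat -> set T) (c : R) (m : nat) :
  (forall t, measurable (E t)) -> (forall t, P (E t) = c%:E) ->
  (forall s t, s != t -> P (E s `&` E t) = (c * c)%:E) ->
  \int[P]_w ((\sum_(t < m) (\1_(E t) w - c)) ^+ 2)%R%:E <= m%:R%:E.
Proof.
move=> mE PE PEE.
have c0 : (0 <= c)%R by rewrite -lee_fin -(PE 0%N).
pose Y w := (\sum_(t < m) \1_(E t) w)%R : R.
pose X w := (\sum_(st : 'I_m * 'I_m) \1_(E st.1 `&` E st.2) w)%R : R.
have mY : measurable_fun setT Y.
  by apply: measurable_sum => t; exact: measurable_indic.
have mX : measurable_fun setT X.
  by apply: measurable_sum => st; apply: measurable_indic; exact: measurableI.
have X0 w : (0 <= X w)%R by rewrite sumr_ge0.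
have Y0 w : (0 <= Y w)%R by rewrite sumr_ge0.
have devE w : (\sum_(t < m) (\1_(E t) w - c) = Y w - m%:R * c)%R.
  by rewrite sumrB sumr_const card_ord mulr_natl.
have XE w : X w = (Y w ^+ 2)%R.
  rewrite /X -(pair_bigA _ (fun s t : 'I_m => \1_(E s `&` E t) w)) /=.
  rewrite expr2 /Y mulr_suml; apply: eq_bigr => s _; rewrite mulr_sumr.
  by apply: eq_bigr => t _; rewrite indicI.
have IY : \int[P]_w (Y w)%:E = (m%:R * c)%:E.
  rewrite integral_sum_indic; last by move=> t; exact: mE.
  by under eq_bigr do rewrite PE; rewrite sumEFin sumr_const card_ord mulr_natl.
have IX : \int[P]_w (X w)%:E = (m%:R * c + (m%:R ^+ 2 - m%:R) * c ^+ 2)%:E.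
  rewrite integral_sum_indic; last by move=> st; exact: measurableI.
  rewrite -(pair_bigA _ (fun s t : 'I_m => P (E s `&` E t))) /=.
  under eq_bigr => s _.
    (* Every pair contributes [c * c], with a correction on the diagonal, where the intersection is
       [E s] itself. *)
    rewrite (eq_bigr (fun t : 'I_m =>
      (c * c + (if t == s then c - c * c else 0))%:E)); last first.
      move=> t _; case: eqVneq => [->|ts]; last by rewrite addr0 PEE 1?eq_sym.
      by rewrite setIid PE addrCA subrr addr0.
    rewrite sumEFin big_split /= sumr_const card_ord -big_mkcond big_pred1_eq.
    over.
  rewrite sumEFin sumr_const card_ord -mulr_natl -[((c * c) *+ m)%R]mulr_natl.
  by congr EFin; ring.
pose N w := ((\sum_(t < m) (\1_(E t) w - c)) ^+ 2)%R : R.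
have mN : measurable_fun setT N.
  apply: measurable_funX; apply: measurable_sum => t.
  by apply: measurable_funB => //; exact: measurable_indic.
(* The square is expanded with its cross term moved to the left, so that all integrands are
   nonnegative and additivity holds in the extended reals. *)
have key : \int[P]_w (N w)%:E + \int[P]_w (2 * m%:R * c * Y w)%:E =
           \int[P]_w (X w)%:E + \int[P]_w ((m%:R * c) ^+ 2)%:E.
  rewrite -!ge0_integralD //=.
  - apply: eq_integral => w _; rewrite -!EFinD; congr EFin.
    by rewrite XE /N devE; ring.
  - by move=> w _; rewrite lee_fin.
  - exact/measurable_EFinP.
  - by move=> w _; rewrite lee_fin sqr_ge0.
  - by move=> w _; rewrite lee_fin sqr_ge0.
  - exact/measurable_EFinP.
  - by move=> w _; rewrite lee_fin !mulr_ge0.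
  - by apply/measurable_EFinP; apply: measurable_funM.
have cY : \int[P]_w (2 * m%:R * c * Y w)%:E = (2 * (m%:R * c) ^+ 2)%:E.
  under eq_integral do rewrite EFinM.
  rewrite ge0_integralZl_EFin //; last 3 first.
  - by move=> w _; rewrite lee_fin.
  - exact/measurable_EFinP.
  - by rewrite !mulr_ge0.
  by rewrite IY -EFinM; congr EFin; ring.
move: key; rewrite cY IX integral_cst // [X in _ * X]probability_setT mule1 -EFinD.
rewrite -/(N _); set IN := (\int[P]_w _) => key.
have : IN = (m%:R * c - m%:R * c ^+ 2)%:E.
  (* Finiteness is needed before subtracting in the extended reals. *)
  have : IN \is a fin_num.
    by case: IN key.
  move=> /fineK <-.
  move: key; case: IN => //= r [] key; congr EFin; lra.
move=> ->; rewrite lee_fin.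
have c1 : (c <= 1)%R by rewrite -lee_fin -(PE 0%N) probability_le1.
have : (0 <= m%:R :> R)%R by [].
have : (0 <= (c - 1) ^+ 2)%R by exact: sqr_ge0.
nra.
Qed.


Lemma nneseries_inv_sqr_lty : \sum_(j <oo) ((j.+1 ^ 2)%:R^-1 : R)%:E < +oo.
Proof.
apply: (@le_lt_trans _ _ 2%:E); last exact: ltry.
apply: lime_le; first by apply: is_cvg_nneseries => j _ _; rewrite lee_fin.
apply: nearW => n; rewrite sumEFin lee_fin.
(* The subtracted term makes the bound inductive: the term of index [j] is at most
   [2 / j.+1 - 2 / j.+2]. *)
suff : (\sum_(0 <= j < n) ((j.+1 ^ 2)%:R^-1 : R) <= 2 - 2 * n.+1%:R^-1)%R.
  by move=> /le_trans; apply; rewrite lerBlDr lerDl mulr_ge0.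
elim: n => [|n IH]; first by rewrite big_geq // invr1 mulr1 subrr.
rewrite big_nat_recr //=; apply: (le_trans (lerD IH (lexx _))).
rewrite -subr_ge0.
have -> : (2 - 2 * n.+2%:R^-1 - (2 - 2 * n.+1%:R^-1 + (n.+1 ^ 2)%:R^-1) =
    n%:R * ((n.+1 ^ 2)%:R * n.+2%:R)^-1 :> R)%R.
  rewrite !natrX -!(natr1 n.+1) -!(natr1 n); field.
  by rewrite !natr1 !pnatr_eq0.
by rewrite mulr_ge0.
Qed.

(* The variances of the averages are summable along the squares; between two
   consecutive squares the centered count varies too little to matter. *)
Lemma cvg_count_pairwise_independent (E : nat -> set T) (c : R) :
  (forall t, measurable (E t)) -> (forall t, P (E t) = c%:E) ->
  (forall s t, s != t -> P (E s `&` E t) = (c * c)%:E) ->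
  {ae P, forall w, (fun m => m%:R^-1 * \sum_(t < m) \1_(E t) w)%R @ \oo --> c}.
Proof.
move=> mE PE PEE.
pose D m w := (\sum_(t < m) (\1_(E t) w - c))%R : R.
pose u j w := (((j.+1 ^ 2)%:R^-1 * D (j.+1 ^ 2)%N w) ^+ 2)%R : R.
have mD m : measurable_fun setT (D m).
  apply: measurable_sum => t.
  by apply: measurable_funB => //; exact: measurable_indic.
have mu j : measurable_fun setT (u j).
  by apply: measurable_funX; apply: measurable_funM.
have u0 j w : (0 <= u j w)%R by exact: sqr_ge0.
have Iu j : \int[P]_w (u j w)%:E <= ((j.+1 ^ 2)%:R^-1)%:E.
  under eq_integral do rewrite /u exprMn EFinM.
  rewrite ge0_integralZl_EFin //; last 2 first.
  - by move=> w _; rewrite lee_fin sqr_ge0.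
  - by apply/measurable_EFinP; exact: measurable_funX.
  apply: (@le_trans _ _ (((j.+1 ^ 2)%:R^-1 ^+ 2)%:E * (j.+1 ^ 2)%:R%:E)).
    apply: lee_wpmul2l; first by rewrite lee_fin sqr_ge0.
    exact: second_moment_count_le.
  by rewrite -EFinM lee_fin expr2 -mulrA mulVf ?mulr1 // pnatr_eq0.
(* Sum and integral are exchanged, so the series has finite integral; it is then finite almost
   everywhere, and its terms tend to 0. *)
have : P.-integrable setT (fun w => \sum_(j <oo) (u j w)%:E).
  apply/integrableP; split.
    apply: ge0_emeasurable_sum => [j w _ _|j _]; first by rewrite lee_fin.
    exact/measurable_EFinP.
  under eq_integral => w _.
    rewrite gee0_abs; last by apply: nneseries_ge0 => j _ _; rewrite lee_fin.
    over.
  rewrite integral_nneseries //; last 2 first.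
  - by move=> j; exact/measurable_EFinP.
  - by move=> j w _; rewrite lee_fin.
  apply: le_lt_trans nneseries_inv_sqr_lty.
  apply: lee_nneseries => [j _ _|j _]; last exact: Iu.
    by apply: integral_ge0 => w _; rewrite lee_fin.
move=> /(integrable_ae measurableT); apply: filterS => w /(_ I) ufin.
have uw : (u ^~ w) @ \oo --> 0%R.
  apply/cvg_series_cvg_0/nnseries_is_cvg => //.
  by rewrite ltey_eq ufin.
have Dw : (fun m => m%:R^-1 * D m w)%R @ \oo --> 0%R.
  apply: cvg_average_of_squares => [m|].
    rewrite /D big_ord_recr /= addrAC subrr add0r indicE.
    have c0 : (0 <= c)%R by rewrite -lee_fin -(PE 0%N).
    have c1 : (c <= 1)%R by rewrite -lee_fin -(PE 0%N) probability_le1.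
    by case: (w \in E m); rewrite ler_norml; apply/andP; split; rewrite /=; lra.
  apply/cvgrPdist_le => e e0.
  have /cvgrPdist_le /(_ (e ^+ 2)%R) := uw.
  rewrite exprn_gt0 // => /(_ isT); apply: filterS => j.
  rewrite !sub0r !normrN /u normrX ler_pXn2r // nnegrE ?normr_ge0 //.
  exact: ltW.
rewrite -[c]add0r.
apply: cvg_trans (cvgD Dw (cvg_cst c)); apply: near_eq_cvg.
(* At [m = 0] the average is 0 by convention, so adding back [c] is valid only from 1 on. *)
exists 1%N => // m /= m0.
rewrite fctE /D sumrB sumr_const card_ord -[(c *+ m)%R]mulr_natl mulrBr mulrA.
by rewrite mulVf ?mul1r ?subrK // pnatr_eq0 -lt0n.
Qed.

End events.

(** * Limits of matrices and of finite sums *)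

Lemma cvg_mx_entries (R : realType) (p q : nat) (M : nat -> 'M[R]_(p, q))
    (N : 'M[R]_(p, q)) :
  (forall i j, (fun m => M m i j) @ \oo --> N i j) -> M @ \oo --> N.
Proof.
move=> MN; apply/cvgrPdist_le => /= e e0.
have : \forall m \near \oo, forall i j, `|N i j - M m i j| <= e.
  apply: filter_forall => i; apply: filter_forall => j.
  by have /cvgrPdist_le := MN i j; apply.
apply: filterS => m H.
rewrite /Num.Def.normr/= mx_normrE (bigmax_le _ (ltW e0))//= => -[i j] _.
by rewrite !mxE.
Qed.

Lemma cvg_sumr (R : realType) (I : finType) (f : I -> nat -> R) (a : I -> R) :
  (forall i, f i @ \oo --> a i) ->
  (fun m => \sum_i f i m) @ \oo --> \sum_i a i.
Proof.
move=> fa; have -> : (fun m => \sum_i f i m) = \sum_i f i.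
  by apply/funext => m; rewrite fct_sumE.
elim/big_ind2 : _ => [|g b h c gb hc|i _]; [exact: cvg_cst|exact: cvgD|exact: fa].
Qed.

(** * Averages of multiaffine functions of Bernoulli variables *)

Section averages.
Context {R : realType} {n : nat} {disp : measure_display}
  {Omega : measurableType disp} (P : probability Omega R)
  (b : nat -> 'I_n -> {RV P >-> bool}) (q : R).
Hypothesis b_true : forall t i, P (b t i @^-1` [set true]) = q%:E.
Hypothesis b_indep : mutually_independent (fun ti : nat * 'I_n => b ti.1 ti.2).

(** The event on which the monomial indexed by [S] equals 1 in draw [t]. *)
Let selected (S : {set 'I_n}) (t : nat) : set Omega :=
  [set w | forall i, i \in S -> b t i w].

(** The indices of the variables that determine [selected S t]; they present it as a finite
    intersection, the form used by [mutually_independent]. *)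
Let J (S : {set 'I_n}) (t : nat) : {fset nat * 'I_n} :=
  [fset (t, i) | i in S]%fset.

Let selectedE S t : selected S t =
  \bigcap_(ti in [set` J S t]) (b ti.1 ti.2 @^-1` [set true]).
Proof.
apply/seteqP; split=> w /=.
  by move=> wS [_ _] /imfsetP[i /= iS [-> ->]]; exact: wS.
by move=> wJ i iS; apply: (wJ (t, i)) => /=; apply/imfsetP; exists i.
Qed.

Let P_fset (K : {fset nat * 'I_n}) :
  P (\bigcap_(ti in [set` K]) (b ti.1 ti.2 @^-1` [set true])) = (q ^+ #|` K|)%:E.
Proof.
rewrite (b_indep (A := fun=> [set true])) //.
under eq_bigr do rewrite b_true.
by rewrite prodEFin big_const_seq count_predT iter_mulr_1.
Qed.

Let card_J S t : #|` J S t| = #|S|.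
Proof.
by rewrite card_imfset => [|i j []//]; rewrite cardE.
Qed.

(** By linearity it suffices to treat monomials. For fixed [S], the events [selected S t] have
    probability [q ^+ #|S|] and are pairwise independent in [t], so the law of large numbers
    applies; finitely many [S] share one null set. *)
Lemma cvg_average_multiaffine (f : ('I_n -> R) -> R) : multiaffine f ->
  {ae P, forall w, (fun m => m%:R^-1 * \sum_(t < m) f (fun i => (b t i w)%:R))
    @ \oo --> f (fun=> q)}.
Proof.
move=> [c fE].
have : {ae P, forall w, forall S : {set 'I_n},
    (fun m => m%:R^-1 * \sum_(t < m) \1_(selected S t) w) @ \oo --> q ^+ #|S|}.
  apply: filter_forall => S; apply: cvg_count_pairwise_independent.
  - move=> t; rewrite selectedE; apply: fin_bigcap_measurable => // ti _.
    by rewrite -[X in measurable X]setTI; exact: measurable_funPT.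
  - by move=> t; rewrite selectedE P_fset card_J.
  (* Distinct draws involve disjoint sets of indices, so the exponents add up. *)
  - move=> s t st; rewrite !selectedE -bigcap_setU -set_fsetU P_fset -exprD.
    rewrite cardfsU !card_J; suff -> : (J S s `&` J S t = fset0)%fset.
      by rewrite cardfs0 subn0.
    apply/fsetP => -[r i]; rewrite inE [RHS]inE; apply/negbTE/negP.
    move=> /andP[/imfsetP[j _ [-> _]] /imfsetP[k _ [ts _]]].
    by rewrite ts eqxx in st.
apply: filterS => w H.
rewrite fE.
have -> : (fun m => m%:R^-1 * \sum_(t < m) f (fun i => (b t i w)%:R)) =
    (fun m => \sum_S c S * (m%:R^-1 * \sum_(t < m) \1_(selected S t) w)).
  apply/funext => m.
  under eq_bigr do rewrite fE.
  rewrite exchange_big mulr_sumr; apply: eq_bigr => S _.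
  rewrite -mulr_sumr mulrCA; congr (_ * (_ * _)); apply: eq_bigr => t _.
  rewrite indicE; have [wS|wS] := boolP (w \in selected S t).
    rewrite inE in wS; rewrite big1 // => i iS.
    by rewrite (wS i iS).
  have [i iS biw] : exists2 i, i \in S & ~~ b t i w.
    apply: contrapT => all_b; move/negP: wS; apply; rewrite inE => i iS.
    by apply/negPn/negP => biw; apply: all_b; exists i.
  by rewrite (bigD1 i) //= (negbTE biw) mul0r.
apply: cvg_sumr => S; rewrite prodr_const.
exact: cvgMl_tmp.
Qed.

End averages.

(** * Convergence of the determinant-weighted averages *)

Lemma multiaffine_adj_mulmx (R : comNzRingType) (n m : nat) (A : 'M[R]_m)
    (u : 'I_n -> 'cV[R]_m) (v : 'I_n -> 'rV[R]_m) (g : 'cV[R]_m) (r : 'I_m) :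
  multiaffine (fun y => (\adj (A + \sum_i y i *: (u i *m v i)) *m g) r 0).
Proof.
apply: (multiaffine_ext (f := fun y => \sum_s g s 0 *
    (\adj (A + \sum_i y i *: (u i *m v i))) r s)).
  by move=> y; rewrite [RHS]mxE; apply: eq_bigr => s _; rewrite mulrC.
by apply: multiaffine_sum => s; apply: multiaffineZ; exact: multiaffine_adj.
Qed.

Theorem corollary3 (R : realType) (d n : nat)
    (x : 'I_n -> 'cV[R]_d) (l : 'I_n -> R -> R) (lambda k : R)
    (disp : measure_display) (Omega : measurableType disp)
    (P : probability Omega R) (b : nat -> 'I_n -> {RV P >-> bool})
    (w : 'cV[R]_d)
    (l_convex : forall i, convex_function (setT : set R^o) (l i))
    (l_diff2 : forall i, twice_differentiable (l i))
    (l_smooth : forall i, smooth (l i))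
    (lambda_gt0 : 0 < lambda) (k_gt0 : 0 < k) (k_le_n : k <= n%:R)
    (b_bernoulli : forall t i, distribution P (b t i) = bernoulli_prob (k / n%:R)
       :> (set bool -> \bar R))
    (b_indep : mutually_independent (fun ti : nat * 'I_n => b ti.1 ti.2)) :
  let L := loss x l lambda in
  let Lhat (t : nat) (omega : Omega) :=
    subsampled_loss x l lambda k (fun i => b t i omega) in
  let a t omega := \det (hessian (Lhat t omega) w) in
  let phat t omega := invmx (hessian (Lhat t omega) w) *m gradient L w in
  let p := invmx (hessian L w) *m gradient L w in
  {ae P, forall omega,
    (fun m : nat => (\sum_(t < m) a t omega)^-1 *:
                    (\sum_(t < m) a t omega *: phat t omega)) @ \oo --> p}.
Proof.
move=> L Lhat a phat p.
have n_gt0 : 0 < n%:R :> R by exact: lt_le_trans k_le_n.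
(* The curvatures and [k^-1] are absorbed into the left vectors, leaving the bare Bernoulli
   variables as arguments of [H]. *)
pose u i := (k^-1 * (l i)^`()^`()%classic (dot w (x i))) *: x i.
pose H (y : 'I_n -> R) := lambda%:M + \sum_i y i *: (u i *m (x i)^T).
have ridgeH y : hessian (ridge l x lambda (fun i => k^-1 * y i)) w = H y.
  rewrite hessian_ridge //; congr (_ + _); apply: eq_bigr => i _.
  by rewrite /u -scalemxAl scalerA mulrA [y i * _]mulrC.
have H_unit y : (forall i, 0 <= y i) -> H y \in unitmx.
  move=> y_ge0; rewrite -ridgeH hessian_ridge //.
  apply: unitmx_add_rank1_ge0 => // i.
  by rewrite !mulr_ge0 ?invr_ge0 ?(ltW k_gt0) // convex_derive2_ge0.
(* Replacing each variable by its mean turns the weight [k^-1] into [k^-1 * (k / n)], that is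
   [n^-1]. *)
have LE : hessian L w = H (fun=> k / n%:R).
  rewrite -ridgeH; apply: (congr1 (hessian^~ w)); apply/funext => v.
  rewrite /L /loss /ridge mulr_sumr; congr (_ + _); apply: eq_bigr => i _.
  by rewrite mulrA mulVf ?mul1r // gt_eqF.
have LhatE t omega : hessian (Lhat t omega) w = H (fun i => (b t i omega)%:R).
  rewrite -ridgeH; apply: (congr1 (hessian^~ w)); apply/funext => v.
  rewrite /Lhat /subsampled_loss /ridge mulr_sumr; congr (_ + _).
  by apply: eq_bigr => i _; rewrite mulrA.
have b_true t i : P (b t i @^-1` [set true]) = (k / n%:R)%:E.
  have := congr1 (fun mu => mu [set true]) (b_bernoulli t i).
  rewrite bernoulli_probE; last by rewrite divr_ge0 ?ler_pdivrMr ?mul1r // ltW.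
  by rewrite !diracE mem_set // memNset // mule1 mule0 adde0.
pose g := gradient L w.
have cvg_det := cvg_average_multiaffine b_true b_indep
  (multiaffine_det lambda%:M u (fun i => (x i)^T)).
have cvg_adj : {ae P, forall omega, forall r,
    (fun m => m%:R^-1 * \sum_(t < m) (\adj (H (fun i => (b t i omega)%:R)) *m g) r 0)
    @ \oo --> (\adj (H (fun=> k / n%:R)) *m g) r 0}.
  apply: filter_forall => r.
  exact: (cvg_average_multiaffine b_true b_indep
    (multiaffine_adj_mulmx lambda%:M u (fun i => (x i)^T) g r)).
move: cvg_det cvg_adj; apply: filterS2 => omega cvg_det cvg_adj.
have Hq_unit : H (fun=> k / n%:R) \in unitmx.
  by apply: H_unit => _; rewrite divr_ge0 // ltW.
apply: cvg_mx_entries => r s; rewrite (ord1 s) {s}.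
have -> : p r 0 =
    (\det (H (fun=> k / n%:R)))^-1 * (\adj (H (fun=> k / n%:R)) *m g) r 0.
  by rewrite /p LE /invmx Hq_unit -scalemxAl mxE.
have det_neq0 : \det (H (fun=> k / n%:R)) != 0 by rewrite -unitfE -unitmxE.
(* The quotient of sums is the quotient of averages, the factors [m^-1] cancelling for [m]
   nonzero. *)
apply: (cvg_trans _ (cvgM (cvgV det_neq0 cvg_det) (cvg_adj r))).
apply: near_eq_cvg; exists 1%N => // m /= m_gt0.
have m_neq0 : m%:R != 0 :> R by rewrite pnatr_eq0 -lt0n.
rewrite invfM invrK mulrACA mulfV // mul1r.
rewrite mxE summxE; congr (_^-1 * _).
  by apply: eq_bigr => t _; rewrite /a LhatE.
(* On units [invmx] is the adjugate divided by the determinant, which the weight [a t omega]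
   cancels. *)
apply: eq_bigr => t _; rewrite /a /phat LhatE /invmx H_unit //.
rewrite -scalemxAl scalerA mulfV ?scale1r //.
by rewrite -unitfE -unitmxE H_unit.
Qed.
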